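(* Let $S_k=X_{k+1}-X_k$ and $T_k=D_{k+1}-D_k$ be computed at the $k$-th iteration of sPALM applied to the problem $\min_{D,X}\|Y-DX\|_F^2+\delta_{\Omega_{n,\kappa}}(D)+\delta_{\Gamma^{(\tau)}_{\kappa,p}}(X)$. Assume that $\langle S_k,(D_k^TD_k)S_k\rangle\neq0$ and $\langle T_k,T_k(X_{k+1}X_{k+1}^T)\rangle\neq0$. Then the BB stepsizes take the form $$\alpha_{X_{k+1}}^{BB1}=\frac12\frac{\langle S_k,S_k\rangle}{\langle S_k,(D_k^TD_k)S_k\rangle},\qquad \alpha_{X_{k+1}}^{BB2}=\frac12\frac{\langle S_k,(D_k^TD_k)S_k\rangle}{\langle(D_k^TD_k)S_k,(D_k^TD_k)S_k\rangle},$$ $$\alpha_{D_{k+1}}^{BB1}=\frac12\frac{\langle T_k,T_k\rangle}{\langle T_k,T_k(X_{k+1}X_{k+1}^T)\rangle},\qquad \alpha_{D_{k+1}}^{BB2}=\frac12\frac{\langle T_k,T_k(X_{k+1}X_{k+1}^T)\rangle}{\langle T_k(X_{k+1}X_{k+1}^T),T_k(X_{k+1}X_{k+1}^T)\rangle},$$ and the following bounds hold: $$\frac1{L_{X_k}}\le\alpha_{X_{k+1}}^{BB2}\le\min\Big\{\alpha_{X_{k+1}}^{BB1},\frac1{2\sigma_{\min}^2(D_k)}\Big\},\qquad \frac1{L_{D_{k+1}}}\le\alpha_{D_{k+1}}^{BB2}\le\min\Big\{\alpha_{D_{k+1}}^{BB1},\frac1{2\sigma_{\min}^2(X_{k+1})}\Big\},$$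 where $\sigma_{\min}(D_k)$ and $\sigma_{\min}(X_{k+1})$ are the smallest nonzero singular values of $D_k$ and $X_{k+1}$, respectively, $L_{X_k}=2\|D_k^TD_k\|_2$ and $L_{D_{k+1}}=2\|X_{k+1}X_{k+1}^T\|_2$.
   Context: $Y\in\mathbb{R}^{n\times p}$, $D\in\mathbb{R}^{n\times\kappa}$, $X\in\mathbb{R}^{\kappa\times p}$, $\kappa>n$. $\Omega_{n,\kappa}$ is the set of $n\times\kappa$ matrices with unit Euclidean norm columns; $\Gamma^{(\tau)}_{\kappa,p}$ is the set of $\kappa\times p$ matrices whose columns each have at most $\tau$ nonzero entries; $\delta_\Omega$ is the indicator function ($0$ on $\Omega$, $+\infty$ outside). $\langle A,B\rangle=\mathrm{trace}(A^TB)$; $\|\cdot\|_2$ is the spectral norm. Write $H(D,X)=\|Y-DX\|_F^2$. sPALM applied to this problem is an alternating proximal-gradient method: at iteration $k$, from $(X_k,D_k)$, it first updates $X$ with $D_k$ fixed, giving $X_{k+1}\in P_{\Gamma^{(\tau)}_{\kappa,p}}(X_k-\bar\alpha\nabla_XH(D_k,X_k))$, and then updates $D$ with $X_{k+1}$ fixed, giving $D_{k+1}\in P_{\Omega_{n,\kappa}}(D_k-\bar\alpha'\nabla_DH(D_k,X_{k+1}))$, where $P$ denotes Frobenius-norm projection and $\bar\alpha,\bar\alpha'>0$ are obtained by backtracking from stepsizes determined by the algorithm. The BB (Barzilai–Borwein) stepsizes, for a variable difference $s$ and the corresponding difference $g$ of partial gradients, are defined by $\alpha^{BB1}=\frac{\langle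 s,s\rangle}{\langle s,g\rangle}$ and $\alpha^{BB2}=\frac{\langle s,g\rangle}{\langle g,g\rangle}$. Specifically, $\alpha_{X_{k+1}}^{BB1},\alpha_{X_{k+1}}^{BB2}$ use $s=S_k$, $g=\nabla_XH(D_k,X_{k+1})-\nabla_XH(D_k,X_k)$; $\alpha_{D_{k+1}}^{BB1},\alpha_{D_{k+1}}^{BB2}$ use $s=T_k$, $g=\nabla_DH(D_{k+1},X_{k+1})-\nabla_DH(D_k,X_{k+1})$. *)

(* Defs.v *)
From mathcomp Require Import all_boot all_order all_algebra.
From mathcomp Require Import all_classical all_reals all_analysis.

Set Implicit Arguments.
Unset Strict Implicit.
Unset Printing Implicit Defensive.

Import Order.TTheory GRing.Theory Num.Theory.
Import numFieldNormedType.Exports.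

Local Open Scope classical_set_scope.
Local Open Scope ring_scope.

Definition inner {R : realType} {m n : nat} (A B : 'M[R]_(m, n)) : R :=
  \tr (A^T *m B).

(* On column vectors this is the Euclidean norm. The canonical norm [`|A|] on
   ['M[R]_(m, n)] is the entrywise maximum, hence not used here; it only
   provides the topology in which derivatives are taken. *)
Definition frob {R : realType} {m n : nat} (A : 'M[R]_(m, n)) : R :=
  Num.sqrt (\sum_i \sum_j A i j ^+ 2).

(* The operator norm induced by the Euclidean norms. *)
Definition spectral_norm {R : realType} {m n : nat} (A : 'M[R]_(m, n)) : R :=
  sup [set frob (A *m x) | x in [set x : 'cV[R]_n | frob x <= 1]].

(* A wide matrix gets extra zero singular values from the kernel of [A^T *m A];
   only the nonzero ones are used below. *)
Definition singular_value {R : realType} {m n : nat}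
    (A : 'M[R]_(m, n)) (s : R) : Prop :=
  0 <= s /\ eigenvalue (A^T *m A) (s ^+ 2).

(* The set is finite, so for [A != 0] the infimum is a minimum. For [A = 0] the
   set is empty and the value is the junk [inf set0 = 0]. *)
Definition sigma_min {R : realType} {m n : nat} (A : 'M[R]_(m, n)) : R :=
  inf [set s | singular_value A s /\ s != 0].

(* The matrix of partial derivatives: ['D_v f A] is the derivative of [f] at [A]
   in the direction [v]. *)
Definition grad {R : realType} {m n : nat}
    (f : 'M[R]_(m, n) -> R) (A : 'M[R]_(m, n)) : 'M[R]_(m, n) :=
  \matrix_(i, j) 'D_(delta_mx i j) (f : 'M[R]_(m, n) -> R^o) A.

Section SparseCoding.
Variables (R : realType) (n kappa p : nat).
Implicit Types (Y : 'M[R]_(n, p)) (D : 'M[R]_(n, kappa)).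
Implicit Types (X : 'M[R]_(kappa, p)).

Definition Omega : set 'M[R]_(n, kappa) :=
  [set D : 'M[R]_(n, kappa) | forall j, frob (col j D) = 1].

Definition Gamma (tau : nat) : set 'M[R]_(kappa, p) :=
  [set X : 'M[R]_(kappa, p) |
    forall j, (#|[pred i | (X i j != 0)%R]| <= tau)%N].

Definition H Y D X : R := frob (Y - D *m X) ^+ 2.

Definition gradX Y D X : 'M[R]_(kappa, p) := grad (fun X' => H Y D X') X.

Definition gradD Y D X : 'M[R]_(n, kappa) := grad (fun D' => H Y D' X) D.

End SparseCoding.

(* Set-valued, as [C] need not be convex. *)
Definition proj {R : realType} {m n : nat}
    (C : set 'M[R]_(m, n)) (Z : 'M[R]_(m, n)) : set 'M[R]_(m, n) :=
  [set W | C W /\ forall V, C V -> frob (Z - W) <= frob (Z - V)].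

(* [a] and [a'] are the stepsizes accepted by backtracking. Only their positivity
   is recorded, so every backtracking rule is covered. *)
Definition sPALM_step {R : realType} {n kappa p : nat}
    (Y : 'M[R]_(n, p)) (tau : nat) (a a' : R)
    (Xk : 'M[R]_(kappa, p)) (Dk : 'M[R]_(n, kappa))
    (Xk1 : 'M[R]_(kappa, p)) (Dk1 : 'M[R]_(n, kappa)) : Prop :=
  [/\ 0 < a, 0 < a',
      proj (Gamma tau) (Xk - a *: gradX Y Dk Xk) Xk1 &
      proj (@Omega R n kappa) (Dk - a' *: gradD Y Dk Xk1) Dk1].

(* Only the iterations up to the [k]-th one are constrained, so that runs
   stopped after iteration [k] are covered. *)
Definition sPALM_run {R : realType} {n kappa p : nat}
    (Y : 'M[R]_(n, p)) (tau : nat) (a a' : nat -> R)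
    (X : nat -> 'M[R]_(kappa, p)) (D : nat -> 'M[R]_(n, kappa))
    (k : nat) : Prop :=
  forall i, (i <= k)%N ->
    sPALM_step Y tau (a i) (a' i) (X i) (D i) (X i.+1) (D i.+1).

Definition BB1 {R : realType} {m n : nat} (s g : 'M[R]_(m, n)) : R :=
  inner s s / inner s g.

Definition BB2 {R : realType} {m n : nat} (s g : 'M[R]_(m, n)) : R :=
  inner s g / inner g g.

(* Main.v *)
(* Both partial gradients of [H] are affine, so the gradient difference is twice
   the Gram matrix [G = A^T *m A] applied to the variable difference [S] (with
   [A = D k], and [A = (X k.+1)^T] after transposing), which gives the formulas.
   The bounds are [<GS,GS> <= |G| <S,GS>], Cauchy-Schwarz, and
   [sigma_min A ^+ 2 * <S,GS> <= <GS,GS>]. The last one holds because in an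
   eigenbasis of [G] it reads [sigma_min A ^+ 2 * r i <= r i ^+ 2] for each
   eigenvalue [r i], which is [0] or at least [sigma_min A ^+ 2]. *)
Require Import Defs.
From mathcomp Require Import all_boot all_order all_algebra.
From mathcomp Require Import all_classical all_reals all_analysis.
From mathcomp Require Import spectral complex polyrcf ring lra.

Set Implicit Arguments.
Unset Strict Implicit.
Unset Printing Implicit Defensive.

Import Order.TTheory GRing.Theory Num.Theory.
Import numFieldNormedType.Exports.

Local Open Scope classical_set_scope.
Local Open Scope ring_scope.

(** * Frobenius inner product, spectral norm, gradients of quadratic functions *)

Section Inner.
Variable R : realType.
Implicit Types m n q : nat.

Lemma innerE m n (A B : 'M[R]_(m, n)) :
  inner A B = \sum_i \sum_j A i j * B i j.
Proof.
rewrite /inner /mxtrace exchange_big; apply: eq_bigr => j _; rewrite mxE.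
by apply: eq_bigr => i _; rewrite mxE.
Qed.

Lemma innerC m n (A B : 'M[R]_(m, n)) : inner A B = inner B A.
Proof. by rewrite /inner -mxtrace_tr trmx_mul trmxK. Qed.

Lemma innerDr m n (A B C : 'M[R]_(m, n)) :
  inner A (B + C) = inner A B + inner A C.
Proof. by rewrite /inner mulmxDr mxtraceD. Qed.

Lemma innerZr m n a (A B : 'M[R]_(m, n)) : inner A (a *: B) = a * inner A B.
Proof. by rewrite /inner -scalemxAr mxtraceZ. Qed.

Lemma innerDl m n (A B C : 'M[R]_(m, n)) :
  inner (A + B) C = inner A C + inner B C.
Proof. by rewrite innerC innerDr !(innerC C). Qed.

Lemma innerZl m n a (A B : 'M[R]_(m, n)) : inner (a *: A) B = a * inner A B.
Proof. by rewrite innerC innerZr innerC. Qed.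

Lemma inner_mull m n q (A : 'M[R]_(m, n)) (M : 'M[R]_(n, q))
    (N : 'M[R]_(m, q)) :
  inner (A *m M) N = inner M (A^T *m N).
Proof. by rewrite /inner trmx_mul mulmxA. Qed.

Lemma inner_trmx m n (A B : 'M[R]_(m, n)) : inner (A^T) (B^T) = inner A B.
Proof. by rewrite /inner trmxK mxtrace_mulC -mxtrace_tr trmx_mul trmxK. Qed.

Lemma inner_mulr m n q (A : 'M[R]_(n, q)) (M : 'M[R]_(m, n))
    (N : 'M[R]_(m, q)) :
  inner (M *m A) N = inner M (N *m A^T).
Proof.
by rewrite -inner_trmx trmx_mul inner_mull -inner_trmx trmxK trmx_mul !trmxK.
Qed.

Lemma inner_ge0 m n (A : 'M[R]_(m, n)) : 0 <= inner A A.
Proof.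
by rewrite innerE; do 2!apply: sumr_ge0 => ? _; rewrite -expr2 sqr_ge0.
Qed.

Lemma inner_eq0 m n (A : 'M[R]_(m, n)) : (inner A A == 0) = (A == 0).
Proof.
apply/idP/eqP => [|->]; last by rewrite /inner mulmx0 mxtrace0.
rewrite innerE psumr_eq0 => [/allP A0|i _]; last first.
  by apply: sumr_ge0 => ? _; rewrite -expr2 sqr_ge0.
apply/matrixP => i j; rewrite mxE; apply/eqP.
have := A0 i (mem_index_enum i); rewrite psumr_eq0 => [/allP|? _].
  move=> /(_ j (mem_index_enum j)).
  by rewrite -expr2 sqrf_eq0.
by rewrite -expr2 sqr_ge0.
Qed.

Lemma inner_delta m n (A : 'M[R]_(m, n)) i j : inner (delta_mx i j) A = A i j.
Proof.
rewrite innerE (bigD1 i)//= (bigD1 j)//= !mxE !eqxx mul1r.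
rewrite !big1 ?addr0// => [i' i'i|j' j'j].
  by rewrite big1// => j' _; rewrite mxE (negPf i'i) mul0r.
by rewrite mxE (negPf j'j) andbF mul0r.
Qed.

Lemma inner_col m n (A B : 'M[R]_(m, n)) :
  inner A B = \sum_j inner (col j A) (col j B).
Proof.
rewrite innerE exchange_big; apply: eq_bigr => j _; rewrite innerE.
by apply: eq_bigr => i _; rewrite big_ord1 !mxE.
Qed.

Lemma inner_CauchySchwarz m n (A B : 'M[R]_(m, n)) :
  inner A B ^+ 2 <= inner A A * inner B B.
Proof.
have := inner_ge0 A; rewrite le_eqVlt => /orP[|A0].
  rewrite eq_sym inner_eq0 => /eqP->.
  rewrite -[X in inner X B](scale0r B) innerZl mul0r expr0n.
  by rewrite mulr_ge0 ?inner_ge0.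
(* With [a], [b], [c] as named below, this squared norm expands to [a * (a * c - b ^+ 2)], and
   [a > 0] can be cancelled. *)
have := inner_ge0 (inner A A *: B + - inner A B *: A).
rewrite !(innerDl, innerDr, innerZl, innerZr) (innerC B A).
set a := inner A A in A0 *; set b := inner A B; set c := inner B B => H.
rewrite -(ler_pM2l A0) -subr_ge0; apply: le_trans H _.
by rewrite le_eqVlt; apply/orP; left; apply/eqP; ring.
Qed.

Lemma frobE m n (A : 'M[R]_(m, n)) : frob A = Num.sqrt (inner A A).
Proof. by rewrite /frob innerE. Qed.

Lemma sqr_frob m n (A : 'M[R]_(m, n)) : frob A ^+ 2 = inner A A.
Proof. by rewrite frobE sqr_sqrtr ?inner_ge0. Qed.

Lemma frobZ m n a (A : 'M[R]_(m, n)) : frob (a *: A) = `|a| * frob A.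
Proof.
by rewrite !frobE innerZl innerZr mulrA -expr2 sqrtrM ?sqr_ge0// sqrtr_sqr.
Qed.

Lemma frob0 m n : frob (0 : 'M[R]_(m, n)) = 0.
Proof. by rewrite -(scale0r (0 : 'M[R]_(m, n))) frobZ normr0 mul0r. Qed.

(** Cauchy-Schwarz on each row of [A]. This bounds the set whose [sup] is [spectral_norm A], making
    it a genuine supremum. *)
Lemma frob_mulmx m n (A : 'M[R]_(m, n)) (x : 'cV[R]_n) :
  frob (A *m x) <= frob A * frob x.
Proof.
rewrite !frobE -sqrtrM ?inner_ge0// ler_sqrt ?mulr_ge0 ?inner_ge0//.
rewrite [inner (A *m x) _]innerE.
have -> : inner A A = \sum_i inner ((row i A)^T) ((row i A)^T).
  rewrite -inner_trmx inner_col; apply: eq_bigr => i _.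
  by rewrite -tr_row.
rewrite mulr_suml; apply: ler_sum => i _; rewrite big_ord1.
have -> : (A *m x) i 0 = inner ((row i A)^T) x.
  by rewrite /inner trmxK trace_mx11 -row_mul [RHS]mxE.
by rewrite -expr2 inner_CauchySchwarz.
Qed.

Lemma frob_mulmx_spectral m n (A : 'M[R]_(m, n)) (x : 'cV[R]_n) :
  frob (A *m x) <= spectral_norm A * frob x.
Proof.
have sup_ub (y : 'cV[R]_n) : frob y <= 1 -> frob (A *m y) <= spectral_norm A.
  move=> y1; apply: ub_le_sup; last by exists y.
  exists (frob A) => _ [z /= z1 <-]; apply: le_trans (frob_mulmx A z) _.
  by rewrite ler_piMr // sqrtr_ge0.
have := sqrtr_ge0 (inner x x); rewrite -frobE le_eqVlt => /orP[x0|x0].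
  have : inner x x == 0 by rewrite -sqr_frob -(eqP x0) expr0n.
  by rewrite inner_eq0 => /eqP->; rewrite mulmx0 !frob0 mulr0.
rewrite -ler_pdivrMr// mulrC.
have := sup_ub ((frob x)^-1 *: x).
rewrite -scalemxAr !frobZ ger0_norm ?invr_ge0 ?(ltW x0)// => -> //.
by rewrite mulVf ?gt_eqF.
Qed.

Lemma spectral_norm_ge0 m n (A : 'M[R]_(m, n)) : 0 <= spectral_norm A.
Proof.
apply: ub_le_sup; last by exists 0; rewrite ?mulmx0 //= frob0.
exists (frob A) => _ [z /= z1 <-]; apply: le_trans (frob_mulmx A z) _.
by rewrite ler_piMr // sqrtr_ge0.
Qed.

(** Both sides split over the columns of [M], where the operator bound on vectors applies. *)
Lemma inner_mulmx_le m n q (A : 'M[R]_(m, n)) (M : 'M[R]_(n, q)) :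
  inner (A *m M) (A *m M) <= spectral_norm A ^+ 2 * inner M M.
Proof.
rewrite !(inner_col _ M) inner_col mulr_sumr; apply: ler_sum => j _.
rewrite !colE -mulmxA -!sqr_frob -exprMn ler_sqr ?nnegrE ?frob_mulmx_spectral//.
  exact: sqrtr_ge0.
by rewrite mulr_ge0 ?spectral_norm_ge0 ?sqrtr_ge0.
Qed.

Lemma inner_mulmx_spectral m q (G : 'M[R]_m) (M : 'M[R]_(m, q)) :
  inner M (G *m M) <= spectral_norm G * inner M M.
Proof.
have MM0 := inner_ge0 M; have L0 := spectral_norm_ge0 G.
apply: le_trans (ler_norm _) _.
rewrite -ler_sqr ?nnegrE ?mulr_ge0//.
rewrite real_normK ?num_real//; apply: le_trans (inner_CauchySchwarz _ _) _.
by rewrite exprMn expr2 mulrCA ler_wpM2l// -expr2 inner_mulmx_le.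
Qed.

(* With [y = A *m S] and [z = A^T *m y], Cauchy-Schwarz gives
   [<z,z>^2 = <A z,y>^2 <= <z,G z> <y,y> <= |G| <z,z> <y,y>]. *)
Lemma inner_gram_le m n q (A : 'M[R]_(m, n)) (S : 'M[R]_(n, q))
    (G := A^T *m A) :
  inner (G *m S) (G *m S) <= spectral_norm G * inner S (G *m S).
Proof.
set y := A *m S; have GS : G *m S = A^T *m y by rewrite mulmxA.
have -> : inner S (G *m S) = inner y y by rewrite GS -inner_mull.
rewrite GS; set z := A^T *m y; have := inner_ge0 z.
rewrite le_eqVlt => /orP[/eqP<-|z0].
  by rewrite mulr_ge0 ?spectral_norm_ge0 ?inner_ge0.
rewrite -(ler_pM2l z0) -expr2 mulrA.
have -> : inner z z = inner (A *m z) y by rewrite inner_mull.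
apply: le_trans (inner_CauchySchwarz _ _) _.
rewrite ler_wpM2r ?inner_ge0// [inner (A *m z) y]inner_mull -/z mulrC.
by rewrite inner_mull mulmxA inner_mulmx_spectral.
Qed.

(** The difference quotient along [v] is exactly [inner v g + h * q v] for [h != 0], and [v] is
    fixed as [h] tends to 0. Gradients are thus read off an algebraic expansion. *)
Lemma grad_quadratic m n (f : 'M[R]_(m, n) -> R) A g (q : 'M[R]_(m, n) -> R) :
  (forall h v, f (h *: v + A) = f A + h * inner v g + h ^+ 2 * q v) ->
  grad f A = g.
Proof.
move=> fE; apply/matrixP => i j; rewrite mxE /derive.
set v := delta_mx i j; rewrite -(inner_delta g) -/v.
apply: cvg_lim => //.
apply: (@cvg_trans _ ((fun h : R => inner v g + h * q v) @ 0^')).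
  apply: near_eq_cvg; near=> h.
  have h0 : h != 0 by near: h; exact: nbhs_dnbhs_neq.
  by rewrite /= fE /GRing.scale /=; field.
apply: cvg_within_filter.
suff: (fun h : R => inner v g + h * q v) @ (0 : R) --> inner v g + 0 * q v.
  by rewrite mul0r addr0.
by apply: cvgD; [exact: cvg_cst | apply: cvgMl; exact: cvg_id].
Unshelve. all: by end_near. Qed.
End Inner.

(** * Spectral theorem for real symmetric matrices, via the complex extension *)

Section Spectral.
Local Open Scope sesquilinear_scope.
Variable R : realType.

Lemma sum_trC_mulmx (C : numClosedFieldType) m q (U V : 'M[C]_(m, q)) :
  \tr (U^t* *m V) = \sum_i \sum_j (U i j)^* * V i j.
Proof.
rewrite /mxtrace exchange_big; apply: eq_bigr => j _; rewrite mxE.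
by apply: eq_bigr => i _; rewrite !mxE.
Qed.

(* [w i] is the squared norm of the [i]-th row of the coordinates of [S] in an
   orthonormal eigenbasis of [G], taken over the complex extension of [R]. *)
Lemma symmetric_spectral m (G : 'M[R]_m) : G^T = G ->
  exists r : 'I_m -> R, (forall i, eigenvalue G (r i)) /\
  forall q (S : 'M[R]_(m, q)), exists w : 'I_m -> R,
  [/\ forall i, 0 <= w i,
      inner S (G *m S) = \sum_i r i * w i &
      inner (G *m S) (G *m S) = \sum_i r i ^+ 2 * w i].
Proof.
move=> Gsym; pose f := [the {rmorphism R -> complex R} of real_complex R].
pose GC := map_mx f G.
have fr x : f x \is Num.real by apply/complex_realP; exists x.
have fconj x : (f x)^* = f x by rewrite conj_Creal.
have GCherm : GC \is hermsymmx.
  apply: realsym_hermsym; last by apply/mxOverP => i j; rewrite mxE.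
  apply/is_hermitianmxP; rewrite expr0 scale1r map_mx_id//.
  by rewrite map_trmx Gsym.
pose P := spectralmx GC; pose d := spectral_diag GC.
have Pu : P \is unitarymx := spectral_unitarymx GC.
have GCE : GC = invmx P *m diag_mx d *m P.
  exact/orthomx_spectralP/hermitian_normalmx.
have dr i : d 0 i = f (complex.Re (d 0 i)).
  have /mxOverP/(_ 0 i) := hermitian_spectral_diag_real GCherm.
  by move/RRe_real => <-.
exists (fun i => complex.Re (d 0 i)); split.
  (* It suffices to find an eigenvector over the complex extension. Eigenvectors are row vectors
     here, so row [i] of the unitary [P] serves. *)
  move=> i; rewrite -(eigenvalue_map f) -dr; apply/eigenvalueP.
  exists (row i P).
    rewrite -/GC -row_mul GCE !mulmxA mulmxV ?spectral_unit// mul1mx.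
    by rewrite row_mul row_diag_mx -scalemxAl -rowE.
  apply/eqP => /(congr1 (mulmx^~ (invmx P)))/rowP/(_ i).
  rewrite -row_mul mulmxV ?spectral_unit// mul0mx !mxE eqxx => /eqP.
  by rewrite oner_eq0.
move=> q S; pose SC := map_mx f S; pose W := P *m SC.
have SCE : SC = P^t* *m W by rewrite -invmx_unitary// mulKmx ?spectral_unit.
(* The unitary change of basis preserves the inner product, so both traces can be computed in the
   coordinates [W], where [G] acts diagonally. *)
have dot (U V : 'M[complex R]_(m, q)) :
    \tr ((P^t* *m U)^t* *m (P^t* *m V)) = \tr (U^t* *m V).
  rewrite trmx_mul map_mxM trmxCK !mulmxA -[U^t* *m P *m _]mulmxA.
  by rewrite (unitarymxP Pu) mulmx1.
have GSE : map_mx f (G *m S) = P^t* *m (diag_mx d *m W).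
  by rewrite map_mxM -/GC -/SC GCE invmx_unitary// -!mulmxA.
have innerCE (U V : 'M[R]_(m, q)) :
    f (inner U V) = \tr ((map_mx f U)^t* *m map_mx f V).
  rewrite innerE sum_trC_mulmx rmorph_sum; apply: eq_bigr => i _.
  rewrite rmorph_sum; apply: eq_bigr => j _.
  by rewrite rmorphM !mxE fconj.
pose w i := \sum_j `|W i j| ^+ 2.
have wr i : f (complex.Re (w i)) = w i.
  by apply: RRe_real; rewrite rpred_sum// => j _; rewrite rpredX// normr_real.
exists (fun i => complex.Re (w i)); split.
- by move=> i; rewrite -(lecR) wr; apply: sumr_ge0 => j _; rewrite exprn_ge0.
- apply: (fmorph_inj f); rewrite innerCE GSE -/SC SCE dot sum_trC_mulmx.
  rewrite rmorph_sum; apply: eq_bigr => i _; rewrite rmorphM wr -dr.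
  rewrite mulr_sumr; apply: eq_bigr => j _.
  by rewrite normCKC mul_diag_mx [X in _ * X = _]mxE mulrCA.
- apply: (fmorph_inj f); rewrite innerCE GSE dot sum_trC_mulmx.
  rewrite rmorph_sum; apply: eq_bigr => i _; rewrite rmorphM rmorphXn wr -dr.
  rewrite mulr_sumr; apply: eq_bigr => j _.
  rewrite normCKC mul_diag_mx [(\matrix_(_, _) _) i j]mxE rmorphM.
  by rewrite [X in X^* * _ * _]dr fconj -dr mulrACA -expr2.
Qed.
End Spectral.

(** * Nonzero singular values, stepsize bounds, partial gradients of [H] *)

Section BarzilaiBorwein.
Variable R : realType.

Lemma eigenvalue_gram_ge0 m n (A : 'M[R]_(m, n)) e :
  eigenvalue (A^T *m A) e -> 0 <= e.
Proof.
case/eigenvalueP => v vG v0.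
have : inner (v *m A^T) (v *m A^T) = e * inner v v.
  by rewrite inner_mulr trmxK -mulmxA vG innerZr.
have := inner_ge0 (v *m A^T) => /[swap] ->.
by rewrite pmulr_lge0// lt_def inner_eq0 v0 inner_ge0.
Qed.

(** If [v] is an eigenvector of [A *m B], then [v *m A] is one of [B *m A]; it is nonzero because
    [v *m A = 0] would force [e *: v = 0]. *)
Lemma eigenvalue_mulmxC (F : fieldType) m n (A : 'M[F]_(m, n))
    (B : 'M[F]_(n, m)) e :
  e != 0 -> eigenvalue (A *m B) e -> eigenvalue (B *m A) e.
Proof.
move=> e0 /eigenvalueP[v vAB v0]; apply/eigenvalueP; exists (v *m A).
  by rewrite mulmxA -(mulmxA v) vAB -scalemxAl.
apply: contra_neq v0 => vA0; apply: (scalerI e0).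
by rewrite -vAB mulmxA vA0 mul0mx scaler0.
Qed.

Lemma sigma_min_trmx m n (A : 'M[R]_(m, n)) : sigma_min A^T = sigma_min A.
Proof.
rewrite /sigma_min; congr inf; rewrite eqEsubset.
split=> s [[s0 sA] sn0]; split=> //; split=> //; move: sA;
  rewrite ?trmxK; apply: eigenvalue_mulmxC; by rewrite sqrf_eq0.
Qed.

Lemma sigma_min_le m n (A : 'M[R]_(m, n)) e :
  eigenvalue (A^T *m A) e -> e != 0 -> sigma_min A ^+ 2 <= e.
Proof.
move=> Ae en0; have e0 := eigenvalue_gram_ge0 Ae.
have lb : lbound [set s | singular_value A s /\ s != 0] 0.
  by move=> s [[]].
have sqrt_in : [set s | singular_value A s /\ s != 0] (Num.sqrt e).
  split; last by rewrite sqrtr_eq0 -ltNge lt_def en0.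
  by split; rewrite ?sqrtr_ge0// sqr_sqrtr.
rewrite -[leRHS]sqr_sqrtr// ler_sqr ?nnegrE ?sqrtr_ge0//.
  by apply: ge_inf => //; exists 0.
by apply: lb_le_inf => //; exists (Num.sqrt e).
Qed.

(** An infimum of positive numbers could be 0; here the characteristic polynomial has no root in
    some interval []0, c[], so [Num.sqrt c] bounds all nonzero singular values from below. The
    eigenvalue [e] makes the set nonempty. *)
Lemma sigma_min_gt0 m n (A : 'M[R]_(m, n)) e :
  eigenvalue (A^T *m A) e -> e != 0 -> 0 < sigma_min A.
Proof.
move=> Ae en0; set p := char_poly (A^T *m A).
have pn0 : p != 0 by rewrite monic_neq0// char_poly_monic.
(* The first root of [p] between 0 and 1, or 1 if there is none. *)
pose c := next_root p 0 1.
have c0 : 0 < c by rewrite next_root_gt.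
have e0 := eigenvalue_gram_ge0 Ae.
apply: (@lt_le_trans _ _ (Num.sqrt c)); first by rewrite sqrtr_gt0.
apply: lb_le_inf.
  exists (Num.sqrt e); split; last by rewrite sqrtr_eq0 -ltNge lt_def en0.
  by split; rewrite ?sqrtr_ge0// sqr_sqrtr.
move=> s [[s0 As] sn0].
rewrite -(ger0_norm s0) -sqrtr_sqr ler_wsqrtr//.
rewrite leNgt; apply/negP => ltsc.
have /next_noroot/negP[] : s ^+ 2 \in `]0, c[.
  by rewrite in_itv/= ltsc andbT exprn_gt0// lt_def sn0.
by rewrite -eigenvalue_root_char.
Qed.

Lemma sigma_min_gram m n q (A : 'M[R]_(m, n)) (S : 'M[R]_(n, q))
    (G := A^T *m A) : inner S (G *m S) != 0 ->
  0 < sigma_min A /\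
  sigma_min A ^+ 2 * inner S (G *m S) <= inner (G *m S) (G *m S).
Proof.
have Gsym : G^T = G by rewrite trmx_mul trmxK.
have [r [reig /(_ q S)[w [w0 -> ->]]]] := symmetric_spectral Gsym.
move=> Sn0; split.
  (* If all [r i] vanished, so would [inner S (G *m S)]. *)
  have [i rn0] : exists i, r i != 0.
    apply/existsP; apply: contraNT Sn0 => /existsPn r0.
    by rewrite big1// => i _; rewrite (eqP (negPn (r0 i))) mul0r.
  exact: sigma_min_gt0 (reig i) rn0.
rewrite mulr_sumr; apply: ler_sum => i _; rewrite mulrA.
apply: ler_wpM2r => //; have [->|rn0] := eqVneq (r i) 0.
  by rewrite mulr0 expr0n.
rewrite expr2 ler_wpM2r ?sigma_min_le//.
exact: eigenvalue_gram_ge0 (reig i).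
Qed.

Lemma BB_gram_bounds m n q (A : 'M[R]_(m, n)) (S : 'M[R]_(n, q))
    (G := A^T *m A) : inner S (G *m S) != 0 ->
  [/\ 1 / (2 * spectral_norm G) <= BB2 S (2 *: (G *m S)),
      BB2 S (2 *: (G *m S)) <= BB1 S (2 *: (G *m S)) &
      BB2 S (2 *: (G *m S)) <= 1 / (2 * sigma_min A ^+ 2)].
Proof.
move=> b_neq0; have [s0 Hs] := sigma_min_gram b_neq0.
have HL : inner (G *m S) (G *m S) <= spectral_norm G * inner S (G *m S).
  exact: inner_gram_le.
have HCS := inner_CauchySchwarz S (G *m S).
rewrite -/G in Hs.
have b0 : 0 < inner S (G *m S).
  by rewrite lt_def b_neq0 /G -mulmxA -inner_mull inner_ge0.
rewrite /BB1 /BB2 !(innerZl, innerZr).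
move: b0 s0 Hs HL HCS; set b := inner S _; set c := inner (G *m S) _.
set L := spectral_norm _; set s := sigma_min A => b0 s0 Hs HL HCS.
(* All denominators are positive: [c >= s ^+ 2 * b > 0] and [L * b >= c > 0]. Once they are cleared,
   the three goals are [HL], [HCS] and [Hs] up to constants. *)
have c0 : 0 < c by apply: lt_le_trans Hs; rewrite mulr_gt0 ?exprn_gt0.
have L0 : 0 < L by rewrite -(pmulr_lgt0 _ b0); apply: lt_le_trans HL.
have s20 : 0 < s ^+ 2 by rewrite exprn_gt0.
have -> : 2 * b / (2 * (2 * c)) = b / (2 * c) by field; rewrite gt_eqF.
split.
- rewrite ler_pdivlMr ?mulr_gt0// mulrAC ler_pdivrMr ?mulr_gt0//. lra.
- rewrite ler_pdivlMr ?mulr_gt0// mulrAC ler_pdivrMr ?mulr_gt0//. lra.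
- rewrite ler_pdivlMr ?mulr_gt0// mulrAC ler_pdivrMr ?mulr_gt0//. lra.
Qed.

Lemma BB1_scale2 m n (s g : 'M[R]_(m, n)) :
  BB1 s (2 *: g) = 1 / 2 * (inner s s / inner s g).
Proof. by rewrite /BB1 innerZr invfM mul1r mulrCA. Qed.

Lemma BB2_scale2 m n (s g : 'M[R]_(m, n)) :
  BB2 s (2 *: g) = 1 / 2 * (inner s g / inner g g).
Proof.
by rewrite /BB2 !(innerZl, innerZr) -mulf_div divff// !mul1r invfM mulrCA.
Qed.

Lemma BB1_trmx m n (s g : 'M[R]_(m, n)) : BB1 (s^T) (g^T) = BB1 s g.
Proof. by rewrite /BB1 !inner_trmx. Qed.

Lemma BB2_trmx m n (s g : 'M[R]_(m, n)) : BB2 (s^T) (g^T) = BB2 s g.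
Proof. by rewrite /BB2 !inner_trmx. Qed.

(** Used with [C = Y] and [W = D *m X], this gives [H] along a line the form required by
    [grad_quadratic]. *)
Lemma sqr_frob_affine m n h (C V W : 'M[R]_(m, n)) :
  frob (C - (h *: V + W)) ^+ 2 =
  frob (C - W) ^+ 2 + h * (2 * inner V (W - C)) + h ^+ 2 * inner V V.
Proof.
have CB Z : C - Z = -1 *: (Z - C) by rewrite scaleN1r opprB.
rewrite !CB -addrA.
move: (W - C) => Z; rewrite !sqr_frob !(innerDl, innerDr, innerZl, innerZr).
by rewrite (innerC Z V); ring.
Qed.

Lemma gradXE n kappa p (Y : 'M[R]_(n, p)) (D : 'M[R]_(n, kappa)) X :
  gradX Y D X = 2 *: (D^T *m (D *m X - Y)).
Proof.
apply: (grad_quadratic (q := fun V => inner (D *m V) (D *m V))) => h V.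
by rewrite /H (mulmxDr D) -scalemxAr sqr_frob_affine innerZr !inner_mull.
Qed.

Lemma gradDE n kappa p (Y : 'M[R]_(n, p)) D (X : 'M[R]_(kappa, p)) :
  gradD Y D X = 2 *: ((D *m X - Y) *m X^T).
Proof.
apply: (grad_quadratic (q := fun V => inner (V *m X) (V *m X))) => h V.
by rewrite /H (mulmxDl _ _ X) -scalemxAl sqr_frob_affine innerZr !inner_mulr.
Qed.

Lemma gradXB n kappa p (Y : 'M[R]_(n, p)) (D : 'M[R]_(n, kappa)) X X' :
  gradX Y D X' - gradX Y D X = 2 *: (D^T *m D *m (X' - X)).
Proof.
by rewrite !gradXE -scalerBr -mulmxBr opprB addrA subrK -mulmxBr mulmxA.
Qed.

Lemma gradDB n kappa p (Y : 'M[R]_(n, p)) D D' (X : 'M[R]_(kappa, p)) :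
  gradD Y D' X - gradD Y D X = 2 *: ((D' - D) *m (X *m X^T)).
Proof.
by rewrite !gradDE -scalerBr -mulmxBl opprB addrA subrK -mulmxBl mulmxA.
Qed.
End BarzilaiBorwein.

Theorem proposition5p1 (R : realType) (n kappa p tau : nat)
  (n_lt_kappa : (n < kappa)%N) (Y : 'M[R]_(n, p)) (a a' : nat -> R)
  (X : nat -> 'M[R]_(kappa, p)) (D : nat -> 'M[R]_(n, kappa)) (k : nat)
  (run : sPALM_run Y tau a a' X D k) :
  let S := X k.+1 - X k in
  let T := D k.+1 - D k in
  let GX := (D k)^T *m D k in
  let GD := X k.+1 *m (X k.+1)^T in
  let gX := gradX Y (D k) (X k.+1) - gradX Y (D k) (X k) in
  let gD := gradD Y (D k.+1) (X k.+1) - gradD Y (D k) (X k.+1) in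
  let LX := 2 * spectral_norm GX in
  let LD := 2 * spectral_norm GD in
  inner S (GX *m S) != 0 ->
  inner T (T *m GD) != 0 ->
  [/\ BB1 S gX = 1 / 2 * (inner S S / inner S (GX *m S)),
      BB2 S gX = 1 / 2 * (inner S (GX *m S) / inner (GX *m S) (GX *m S)),
      BB1 T gD = 1 / 2 * (inner T T / inner T (T *m GD)) &
      BB2 T gD = 1 / 2 * (inner T (T *m GD) / inner (T *m GD) (T *m GD))] /\
  [/\ 1 / LX <= BB2 S gX,
      BB2 S gX <= Num.min (BB1 S gX) (1 / (2 * sigma_min (D k) ^+ 2)),
      1 / LD <= BB2 T gD &
      BB2 T gD <= Num.min (BB1 T gD) (1 / (2 * sigma_min (X k.+1) ^+ 2))].
Proof.
move=> S T GX GD gX gD LX LD SGS TGT.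
have gXE : gX = 2 *: (GX *m S) := gradXB _ _ _ _.
have gDE : gD = 2 *: (T *m GD) := gradDB _ _ _ _.
have [LXle BB2X sX] := BB_gram_bounds SGS.
(* [GD] acts on [T] from the right; transposing makes it the Gram matrix of [(X k.+1)^T] acting from
   the left, as in [BB_gram_bounds]. *)
have TGtr : (T *m GD)^T = ((X k.+1)^T)^T *m (X k.+1)^T *m T^T.
  by rewrite trmx_mul trmx_mul.
have TGT' : inner (T^T) (((X k.+1)^T)^T *m (X k.+1)^T *m T^T) != 0.
  by rewrite -TGtr inner_trmx.
have [LDle BB2D sD] := BB_gram_bounds TGT'.
(* Back to [T]: the stepsizes and [sigma_min] are invariant under transposition, and the Gram matrix
   of [(X k.+1)^T] is [GD] itself. *)
rewrite -TGtr -linearZ /= trmxK ?BB1_trmx ?BB2_trmx ?sigma_min_trmx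
  in LDle BB2D sD.
split; first by rewrite gXE gDE !BB1_scale2 !BB2_scale2.
by rewrite gXE gDE !le_min BB2X sX BB2D sD.
Qed.
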